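(* Let $\{\theta_i^t\}$, $\{v_i^t\}$, $\{y_i^t\}$ be generated by the MDNPG algorithm (described in the context). Assume: $W$ is doubly stochastic ($W\mathbf 1_n=\mathbf 1_n$, $\mathbf 1_n^{\mathsf T}W=\mathbf 1_n^{\mathsf T}$); $V^\star:=\sup_{\theta\in\mathbb{R}^d}V(\theta)<+\infty$; there are constants $G,M$ with $\|\nabla_\theta\log\pi_\theta(a|s)\|_2^2\le G$ and $\|\nabla^2_\theta\log\pi_\theta(a|s)\|\le M$ for all $\theta,a,s$; and there is $\mu_F>0$ with $F_i(\theta)\succeq\mu_FI_d$ for all $\theta\in\mathbb{R}^d$ and all $i$. Let $\Delta=V^\star-V(\bar\theta^0)$ and $L=\frac{H(M+HG)}{1-\gamma}$. If $0<\eta\le\frac{\mu_F}{8L}$, then $$\frac1n\sum_{t=0}^T\sum_{i=1}^n\|\nabla V(\theta_i^t)\|_2^2\le\frac{8G^2\Delta}{\eta\mu_F}-\frac{G^2}{n}\sum_{t=0}^T\|\mathbf d^t\|_2^2+\frac{76G^2}{\mu_F^2}\sum_{t=0}^T\|\overline{\nabla V}(\theta^t)-\bar v^t\|_2^2+\frac{10G^2}{n\mu_F^2}\sum_{t=0}^T\|\mathbf y^{t+1}-\mathbf 1_n\otimes\bar y^{t+1}\|_2^2+\frac{82G^2L^2}{n\mu_F^2}\sum_{t=0}^T\|\boldsymbol\theta^t-\mathbf 1_n\otimes\bar\theta^t\|_2^2 .$$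
   Context: **Problem.** There are $n$ agents. State and action spaces are finite. Agent $i$ has a reward function $r_i(s,a,s')\in[-1,1]$, a transition model $P_i(s'|s,a)$ and an initial state distribution $\rho_{0,i}$ (environments may coincide for all agents or differ). All agents use the same discount factor $\gamma\in[0,1)$, the same horizon $H\in\mathbb{N}$, and a common parametrized policy $\pi_\theta(a|s)$, $\theta\in\mathbb{R}^d$, with $\log\pi_\theta(a|s)$ twice differentiable in $\theta$. A trajectory $\tau=(s^0,a^0,\dots,s^{H-1},a^{H-1},s^H)$ of agent $i$ under $\pi_\theta$ has distribution $$p_i(\tau|\theta)=\rho_{0,i}(s^0)\prod_{h=0}^{H-1}\pi_\theta(a^h|s^h)P_i(s^{h+1}|s^h,a^h).$$ Put $r_i^h=r_i(s^h,a^h,s^{h+1})$, $V_i(\theta)=\mathbb{E}_{\tau\sim p_i(\cdot|\theta)}\big[\sum_{h=0}^{H-1}\gamma^hr_i^h\big]$ and $V(\theta)=\frac1n\sum_{i=1}^nV_i(\theta)$. **Estimators.** With constant baselines $b_i\in\mathbb{R}$, $$g_i(\tau|\theta)=\Big[\sum_{h=0}^{H-1}\nabla_\theta\log\pi_\theta(a^h|s^h)\Big]\Big[\sum_{h=0}^{H-1}\gamma^hr_i^h-b_i\Big],\qquad \omega(\tau|\tilde\theta,\theta)=\prod_{h=0}^{H-1}\frac{\pi_{\tilde\theta}(a^h|s^h)}{\pi_\theta(a^h|s^h)}.$$ The (scaled) Fisher information matrix of agent $i$ is $$F_i(\theta)=\mathbb{E}_{\tau\sim p_i(\cdot|\theta)}\Big[\frac1H\sum_{h=0}^{H-1}\nabla_\theta\log\pi_\theta(a^h|s^h)\big(\nabla_\theta\log\pi_\theta(a^h|s^h)\big)^{\mathsf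 T}\Big].$$ **Network.** The agents communicate over a connected undirected graph on $\{1,\dots,n\}$; $\mathcal N(i)$ is the set of neighbours of $i$ together with $i$. The nonnegative weight matrix $W=[W_{ij}]\in\mathbb{R}^{n\times n}$ satisfies $W_{ij}=0$ for $j\notin\mathcal N(i)$. $\mathbf 1_n$ is the all-one vector; $\|\cdot\|$ of a matrix is the spectral norm. **MDNPG algorithm.** Inputs: number of iterations $T$, batch size $B\ge1$, learning rate $\eta>0$, momentum parameter $\beta$, initial parameter $\bar\theta^0\in\mathbb{R}^d$. Set $\theta_i^0=\bar\theta^0$, $v_i^{-1}=0$, $y_i^0=0$, $v_i^0=\frac1B\sum_{b=1}^Bg_i(\tau_{i,b}^0|\theta_i^0)$ with $\tau_{i,1}^0,\dots,\tau_{i,B}^0$ i.i.d. from $p_i(\cdot|\theta_i^0)$. For $t=1,\dots,T$, each agent samples one trajectory $\tau_i^t\sim p_i(\cdot|\theta_i^t)$ and sets $$v_i^t=\beta g_i(\tau_i^t|\theta_i^t)+(1-\beta)\big(v_i^{t-1}+g_i(\tau_i^t|\theta_i^t)-\omega(\tau_i^t|\theta_i^{t-1},\theta_i^t)\,g_i(\tau_i^t|\theta_i^{t-1})\big).$$ For $t=0,1,\dots,T$, $$y_i^{t+1}=\sum_{j}W_{ij}(y_j^t+v_j^t-v_j^{t-1}),\qquad \theta_i^{t+1}=\sum_jW_{ij}\big(\theta_j^t+\eta\,\mathbf{H}_j^ty_j^{t+1}\big),\qquad \mathbf{H}_j^t=F_j(\theta_j^t)^{-1}.$$ **Aggregates.**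 $d_i^t=\mathbf H_i^ty_i^{t+1}\in\mathbb{R}^d$. Stacked vectors in $\mathbb{R}^{nd}$: $\boldsymbol\theta^t=(\theta_1^t;\dots;\theta_n^t)$, and similarly $\mathbf y^t$, $\mathbf v^t$, $\mathbf d^t$. Averages in $\mathbb{R}^d$: $\bar\theta^t=\frac1n\sum_i\theta_i^t$, and similarly $\bar y^t,\bar v^t,\bar d^t$. $\overline{\nabla V}(\theta^t)=\frac1n\sum_{i=1}^n\nabla V_i(\theta_i^t)$. $\otimes$ is the Kronecker product. *)

(* Defs.v *)
From HB Require Import structures.
From mathcomp Require Export all_boot all_order all_algebra.
From mathcomp Require Export mxtens.
From mathcomp Require Export all_classical all_reals all_analysis.
Export Order.TTheory GRing.Theory Num.Theory.
Export numFieldNormedType.Exports.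

Set Implicit Arguments.
Unset Strict Implicit.
Unset Printing Implicit Defensive.

Local Open Scope classical_set_scope.
Local Open Scope ring_scope.

Section LinearAlgebra.
Variable R : realType.

(* The library norm on matrices is the max norm, hence a separate l2 norm. *)
Definition l2norm m (x : 'cV[R]_m) : R := Num.sqrt (\sum_k x k 0 ^+ 2).

Definition spectral_norm m p (A : 'M[R]_(m, p)) : R :=
  sup [set l2norm (A *m x) | x in [set x : 'cV[R]_p | l2norm x <= 1]].

Definition psd m (A : 'M[R]_m) : Prop :=
  A^T = A /\ forall x : 'cV[R]_m, 0 <= (x^T *m A *m x) 0 0.

Definition loewner_ge m (A B : 'M[R]_m) : Prop := psd (A - B).

Definition doubly_stochastic n (W : 'M[R]_n) : Prop :=
  [/\ forall i j, 0 <= W i j,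
      W *m (const_mx 1 : 'cV_n) = const_mx 1 &
      (const_mx 1 : 'rV_n) *m W = const_mx 1].

Definition grad m (f : 'cV[R]_m -> R) (x : 'cV[R]_m) : 'cV[R]_m :=
  \col_k 'D_(delta_mx k 0) f x.

Definition hessian m (f : 'cV[R]_m -> R) (x : 'cV[R]_m) : 'M[R]_m :=
  \matrix_(k, l) 'D_(delta_mx l 0) (fun z => 'D_(delta_mx k 0) f z) x.

Definition twice_differentiable m (f : 'cV[R]_m -> R) : Prop :=
  forall x, differentiable f x /\ differentiable (grad f) x.

Definition average n m (x : 'I_n -> 'cV[R]_m) : 'cV[R]_m :=
  n%:R^-1 *: \sum_i x i.

(* (x_1; ...; x_n) in R^(n * m), with the index convention of [tensmx]. *)
Definition stack n m (x : 'I_n -> 'cV[R]_m) : 'cV[R]_(n * m) :=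
  \col_k x (mxtens_unindex k).1 (mxtens_unindex k).2 0.

Definition kron_ones n m (x : 'cV[R]_m) : 'cV[R]_(n * m) :=
  (const_mx 1 : 'cV[R]_n) *t x.

End LinearAlgebra.

Definition connected_graph n (adj : rel 'I_n) : Prop :=
  [/\ symmetric adj, irreflexive adj & forall i j, fingraph.connect adj i j].

Section ReinforcementLearning.
Variables (R : realType) (n H d : nat) (S A : finType).

(* [policy theta s a] is pi_theta(a|s), [trans i s a s'] is P_i(s'|s,a).
   Positivity of the policy is what makes log pi_theta(a|s) meaningful: the
   library's [ln] is 0 on nonpositive reals. *)
Record marl := Marl {
  reward : 'I_n -> S -> A -> S -> R;
  trans : 'I_n -> S -> A -> S -> R;
  init : 'I_n -> S -> R;
  discount : R;
  policy : 'cV[R]_d -> S -> A -> R;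
  reward_bounded : forall i s a s', -1 <= reward i s a s' <= 1;
  trans_ge0 : forall i s a s', 0 <= trans i s a s';
  trans_sum1 : forall i s a, \sum_s' trans i s a s' = 1;
  init_ge0 : forall i s, 0 <= init i s;
  init_sum1 : forall i, \sum_s init i s = 1;
  discount_itv : 0 <= discount < 1;
  policy_gt0 : forall theta s a, 0 < policy theta s a;
  policy_sum1 : forall theta s, \sum_a policy theta s a = 1;
  log_policy_diff2 : forall s a,
    twice_differentiable (fun theta => ln (policy theta s a)) }.

(* The states s^0, ..., s^H and the actions a^0, ..., a^(H-1). *)
Definition traj : finType :=
  ({ffun 'I_H.+1 -> S} * {ffun 'I_H -> A})%type.

Definition state_at (tau : traj) (h : 'I_H) : S := tau.1 (widen_ord (leqnSn H) h).
Definition next_state (tau : traj) (h : 'I_H) : S := tau.1 (lift ord0 h).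
Definition action_at (tau : traj) (h : 'I_H) : A := tau.2 h.

Variable E : marl.

Definition traj_prob (i : 'I_n) (theta : 'cV[R]_d) (tau : traj) : R :=
  init E i (tau.1 ord0) *
  \prod_(h < H) (policy E theta (state_at tau h) (action_at tau h) *
     trans E i (state_at tau h) (action_at tau h) (next_state tau h)).

Definition traj_return (i : 'I_n) (tau : traj) : R :=
  \sum_(h < H) discount E ^+ h *
     reward E i (state_at tau h) (action_at tau h) (next_state tau h).

Definition local_value (i : 'I_n) (theta : 'cV[R]_d) : R :=
  \sum_(tau : traj) traj_prob i theta tau * traj_return i tau.

Definition value (theta : 'cV[R]_d) : R :=
  n%:R^-1 * \sum_(i < n) local_value i theta.

Definition log_policy (s : S) (a : A) (theta : 'cV[R]_d) : R :=
  ln (policy E theta s a).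

Definition score (s : S) (a : A) (theta : 'cV[R]_d) : 'cV[R]_d :=
  grad (log_policy s a) theta.

Definition grad_estimator (b : 'I_n -> R) (i : 'I_n) (tau : traj)
    (theta : 'cV[R]_d) : 'cV[R]_d :=
  (traj_return i tau - b i) *:
    \sum_(h < H) score (state_at tau h) (action_at tau h) theta.

Definition importance_weight (tau : traj) (theta' theta : 'cV[R]_d) : R :=
  \prod_(h < H) (policy E theta' (state_at tau h) (action_at tau h) /
                 policy E theta (state_at tau h) (action_at tau h)).

Definition fisher (i : 'I_n) (theta : 'cV[R]_d) : 'M[R]_d :=
  \sum_(tau : traj) traj_prob i theta tau *: (H%:R^-1 *:
    \sum_(h < H) (score (state_at tau h) (action_at tau h) theta *m
                  (score (state_at tau h) (action_at tau h) theta)^T)).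

Section MDNPG.
Variables (W : 'M[R]_n) (b : 'I_n -> R) (T B : nat) (eta beta : R).
Variable theta0 : 'cV[R]_d.

(* u^(t-1), with the convention u^(-1) = 0. *)
Definition lag (u : nat -> 'I_n -> 'cV[R]_d) (t : nat) (i : 'I_n) : 'cV[R]_d :=
  if t is t'.+1 then u t' i else 0.

(* d_i^t = H_i^t y_i^(t+1) *)
Definition direction (theta y : nat -> 'I_n -> 'cV[R]_d) (t : nat) (i : 'I_n) :
    'cV[R]_d :=
  invmx (fisher i (theta t i)) *m y t.+1 i.

(* The recursion along one realization of the sampled trajectories: [tau0] is
   the initial batch and [tau t] the trajectories of iteration t >= 1. *)
Record mdnpg_recursion (tau0 : 'I_n -> 'I_B -> traj) (tau : nat -> 'I_n -> traj)
    (theta v y : nat -> 'I_n -> 'cV[R]_d) : Prop := {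
  mdnpg_theta0 : forall i, theta 0%N i = theta0;
  mdnpg_y0 : forall i, y 0%N i = 0;
  mdnpg_v0 : forall i,
    v 0%N i = B%:R^-1 *: \sum_(k < B) grad_estimator b i (tau0 i k) (theta 0%N i);
  mdnpg_v : forall t i, (t < T)%N ->
    v t.+1 i = beta *: grad_estimator b i (tau t.+1 i) (theta t.+1 i) +
      (1 - beta) *: (v t i + grad_estimator b i (tau t.+1 i) (theta t.+1 i) -
        importance_weight (tau t.+1 i) (theta t i) (theta t.+1 i) *:
          grad_estimator b i (tau t.+1 i) (theta t i));
  mdnpg_y : forall t i, (t <= T)%N ->
    y t.+1 i = \sum_j W i j *: (y t j + v t j - lag v t j);
  mdnpg_theta : forall t i, (t <= T)%N ->
    theta t.+1 i = \sum_j W i j *: (theta t j + eta *: direction theta y t j) }.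

Section Sampling.
Variables (disp : measure_display) (Omega : measurableType disp).
Variable Pr : probability Omega R.
Variables (tau0 : 'I_n -> 'I_B -> Omega -> traj) (tau : nat -> 'I_n -> Omega -> traj).

(* Outcomes on which all the samples drawn up to iteration t are as in [w0];
   these events are the atoms of the history at iteration t. *)
Definition history (t : nat) (w0 : Omega) : set Omega :=
  [set w | (forall i k, tau0 i k w = tau0 i k w0) /\
           (forall s i, (0 < s <= t)%N -> tau s i w = tau s i w0)].

(* [mdnpg_law0]: the initial batch of agent i is i.i.d. from p_i(.|theta_i^0).
   [mdnpg_law]: given the history up to iteration t, on whose atoms
   theta_i^(t+1) is constant, tau_i^(t+1) has law p_i(.|theta_i^(t+1)). *)
Record mdnpg (theta v y : nat -> 'I_n -> Omega -> 'cV[R]_d) : Prop := {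
  mdnpg_meas0 : forall i k z, measurable [set w | tau0 i k w = z];
  mdnpg_meas : forall t i z, (t < T)%N -> measurable [set w | tau t.+1 i w = z];
  mdnpg_law0 : forall i (z : 'I_B -> traj),
    Pr [set w | forall k, tau0 i k w = z k] =
      (\prod_(k < B) traj_prob i theta0 (z k))%:E;
  mdnpg_law : forall t i z w0, (t < T)%N ->
    Pr (history t w0 `&` [set w | tau t.+1 i w = z]) =
      (Pr (history t w0) * (traj_prob i (theta t.+1 i w0) z)%:E)%E;
  mdnpg_step : forall w, mdnpg_recursion
    (fun i k => tau0 i k w) (fun t i => tau t i w)
    (fun t i => theta t i w) (fun t i => v t i w) (fun t i => y t i w) }.

End Sampling.
End MDNPG.
End ReinforcementLearning.

(* Main.v *)
Require Import Defs.
From mathcomp Require Import ring lra.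

Set Implicit Arguments.
Unset Strict Implicit.
Unset Printing Implicit Defensive.

Local Open Scope classical_set_scope.
Local Open Scope ring_scope.

(** The bound holds along every realization of the samples: it is the ascent
    analysis of gradient steps on V at the averaged parameters, in which the
    sampled quantities only enter through the error terms.

    Smoothness.  With p_i(tau|theta) = c exp (sum_h log pi_theta(a^h|s^h)), the
    log-derivative trick gives the gradient of V_i as the expectation of the
    return times the trajectory score ([grad_local_value]), and one more
    derivative along a line gives the bilinear form [local_value_hess].  The
    return is at most 1/(1-gamma) in absolute value, the trajectory score has
    squared norm at most H^2 G, and the probabilities sum to 1, so this form is
    bounded by L ([normr_local_value_hess_le]).  The mean value theorem then
    yields L-Lipschitz gradients and the ascent inequality
    ([local_value_ascent]).

    Preconditioning.  F_i is at least mu and at most G, so d_i = F_i^-1 y_i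
    satisfies mu |d_i|^2 <= <d_i, y_i> and |y_i| <= G |d_i|.  The first fact makes
    d_i an ascent direction up to the error |g - y_i|^2, with g the gradient of V
    at the averaged parameter ([natural_gradient_ascent]); the second one bounds
    the gradient at theta_i by G |d_i| up to errors.

    One iteration.  Double stochasticity gives that the averaged parameter moves
    by eta times the average direction ([average_theta]) and that the average of
    y^(t+1) is the average of v^t ([average_tracking]).  The mean of |g - y_i|^2
    therefore splits, without cross terms, into |g - average v|^2 and the
    consensus error of y ([mean_sqr_dist]); the former costs the consensus error
    of theta by smoothness.  As eta L <= mu/8, the second-order term of the ascent
    inequality uses up only 1/8 of the first-order gain ([step_bound]).  Summing
    over the iterations telescopes the values of V. *)

(** * Euclidean inner product, averages and operator norm *)

Section InnerProduct.
Variables (R : realType) (m : nat).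
Implicit Types (x y z : 'cV[R]_m) (c : R).

Definition dot x y : R := \sum_k x k 0 * y k 0.

Lemma dotC x y : dot x y = dot y x.
Proof. by apply: eq_bigr => k _; rewrite mulrC. Qed.

Lemma dotDl x y z : dot (x + y) z = dot x z + dot y z.
Proof. by rewrite -big_split; apply: eq_bigr => k _; rewrite mxE mulrDl. Qed.

Lemma dotZl c x y : dot (c *: x) y = c * dot x y.
Proof. by rewrite mulr_sumr; apply: eq_bigr => k _; rewrite mxE mulrA. Qed.

Lemma dotNl x y : dot (- x) y = - dot x y.
Proof. by rewrite -scaleN1r dotZl mulN1r. Qed.

Lemma dot0l y : dot 0 y = 0.
Proof. by rewrite -(scale0r 0) dotZl mul0r. Qed.

Lemma dotDr x y z : dot z (x + y) = dot z x + dot z y.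
Proof. by rewrite !(dotC z) dotDl. Qed.

Lemma dotZr c x y : dot y (c *: x) = c * dot y x.
Proof. by rewrite !(dotC y) dotZl. Qed.

Lemma dotNr x y : dot y (- x) = - dot y x.
Proof. by rewrite !(dotC y) dotNl. Qed.

Lemma dot_suml (I : finType) (F : I -> 'cV[R]_m) y :
  dot (\sum_i F i) y = \sum_i dot (F i) y.
Proof.
by elim/big_rec2: _ => [|i u w _ <-]; rewrite ?dot0l ?dotDl.
Qed.

Lemma dot_sumr (I : finType) (F : I -> 'cV[R]_m) y :
  dot y (\sum_i F i) = \sum_i dot y (F i).
Proof. by rewrite dotC dot_suml; apply: eq_bigr => i _; rewrite dotC. Qed.

Lemma dot_trmx x y : (x^T *m y) 0 0 = dot x y.
Proof. by rewrite mxE; apply: eq_bigr => k _; rewrite mxE. Qed.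

Lemma dot_ge0 x : 0 <= dot x x.
Proof. by apply: sumr_ge0 => k _; rewrite -expr2 sqr_ge0. Qed.

Lemma dot_eq0 x : dot x x = 0 -> x = 0.
Proof.
move=> /eqP; rewrite psumr_eq0 => [/allP h|k _]; last by rewrite -expr2 sqr_ge0.
apply/colP => k; rewrite mxE; apply/eqP.
by have := h k (mem_index_enum _); rewrite mulf_eq0 orbb.
Qed.

Definition dotE := (dotDl, dotDr, dotZl, dotZr, dotNl, dotNr).

Lemma sqr_l2norm x : l2norm x ^+ 2 = dot x x.
Proof.
rewrite sqr_sqrtr; first by apply: eq_bigr => k _; rewrite expr2.
by apply: sumr_ge0 => k _; rewrite sqr_ge0.
Qed.

Lemma l2norm_ge0 x : 0 <= l2norm x.
Proof. exact: sqrtr_ge0. Qed.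

Lemma sqr_dot_le x y : dot x y ^+ 2 <= dot x x * dot y y.
Proof.
have [y0|yn0] := eqVneq (dot y y) 0.
  by rewrite (dot_eq0 y0) dotC dot0l dot0l mulr0 expr0n.
have y_gt0 : 0 < dot y y by rewrite lt_neqAle eq_sym yn0 dot_ge0.
have := dot_ge0 (dot y y *: x - dot x y *: y).
rewrite !dotE (dotC y x) => h.
rewrite -subr_ge0 -(pmulr_rge0 _ y_gt0); apply: le_trans h _.
by rewrite le_eqVlt; apply/orP; left; apply/eqP; ring.
Qed.

Lemma normr_dot_le x y : `|dot x y| <= l2norm x * l2norm y.
Proof.
rewrite -(@ler_pXn2r _ 2) ?nnegrE ?mulr_ge0 ?l2norm_ge0 //.
by rewrite -normrX ger0_norm ?sqr_ge0 // exprMn !sqr_l2norm sqr_dot_le.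
Qed.

(** Convexity of the squared norm with weights 2/5, 1/5, 2/5.  In [step_bound]
    the last coefficient meets the share of the sum of the |d_i|^2 that is
    available, and the other two stay within the constants of the error terms. *)
Lemma sqr_norm_add3_le x y z :
  dot (x + y + z) (x + y + z) <=
  5 / 2 * dot x x + 5 * dot y y + 5 / 2 * dot z z.
Proof.
have h1 := dot_ge0 (2^-1 *: x - y).
have h2 := dot_ge0 (x - z).
have h3 := dot_ge0 (y - 2^-1 *: z).
move: h1 h2 h3; rewrite !dotE (dotC y x) (dotC z x) (dotC z y).
lra.
Qed.

Lemma sqr_norm_add_le x y : dot (x + y) (x + y) <= 2 * dot x x + 2 * dot y y.
Proof.
have := dot_ge0 (x - y); rewrite !dotE (dotC y x); lra.
Qed.

Lemma young_dot c x y : 0 < c ->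
  - (c / 2 * dot y y) - (2 * c)^-1 * dot x x <= dot x y.
Proof.
move=> c_gt0; have := dot_ge0 (x + c *: y); rewrite !dotE (dotC y x) => h.
rewrite -subr_ge0.
have -> : dot x y - (- (c / 2 * dot y y) - (2 * c)^-1 * dot x x) =
  (2 * c)^-1 * (dot x x + c * dot x y + (c * dot x y + c * (c * dot y y))).
  by field; lra.
by rewrite mulr_ge0 // invr_ge0; lra.
Qed.

Lemma l2norm_eq0 x : l2norm x = 0 -> x = 0.
Proof. by move=> h; apply: dot_eq0; rewrite -sqr_l2norm h expr0n. Qed.

Lemma l2normZ c x : l2norm (c *: x) = `|c| * l2norm x.
Proof.
apply/eqP; rewrite -(@eqrXn2 _ 2) ?mulr_ge0 ?l2norm_ge0 //.
by rewrite exprMn !sqr_l2norm !dotE real_normK ?num_real // mulrA expr2.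
Qed.

End InnerProduct.

Section Averages.
Variables (R : realType) (n m : nat).
Implicit Types (x : 'I_n -> 'cV[R]_m) (z : 'cV[R]_m).

Lemma dot_average x z : dot z (average x) = n%:R^-1 * \sum_i dot z (x i).
Proof. by rewrite dotZr dot_sumr. Qed.

Hypothesis n_gt0 : (0 < n)%N.

Let nR_neq0 : n%:R != 0 :> R. Proof. by rewrite pnatr_eq0 -lt0n. Qed.

Lemma mean_const (c : R) : n%:R^-1 * \sum_(i < n) c = c.
Proof. by rewrite sumr_const card_ord -[c *+ n]mulr_natl mulKf. Qed.

(** Bias-variance decomposition: the cross terms vanish because the deviations
    from the average sum to zero. *)
Lemma mean_sqr_dist x z :
  n%:R^-1 * \sum_i dot (z - x i) (z - x i) =
  dot (z - average x) (z - average x) +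
  n%:R^-1 * \sum_i dot (x i - average x) (x i - average x).
Proof.
pose a := average x.
have E (w : 'cV[R]_m) : n%:R^-1 * \sum_i dot (x i - w) (x i - w) =
    n%:R^-1 * \sum_i dot (x i) (x i) - 2 * dot w a + dot w w.
  have -> : \sum_i dot (x i - w) (x i - w) =
      \sum_i (dot (x i) (x i) - 2 * dot w (x i) + dot w w).
    by apply: eq_bigr => i _; rewrite !dotE (dotC w (x i)); ring.
  rewrite big_split sumrB /= mulrDr mean_const dot_average -mulr_sumr; ring.
rewrite -/a E; under eq_bigr => i _.
  rewrite -opprB dotNl dotNr opprK.
  over.
rewrite E; clearbody a; rewrite !dotE (dotC a z); ring.
Qed.

Lemma sqr_average_le x :
  dot (average x) (average x) <= n%:R^-1 * \sum_i dot (x i) (x i).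
Proof.
have := mean_sqr_dist x 0; rewrite !sub0r dotNl dotNr opprK => E.
under [X in _ <= _ * X]eq_bigr => i _.
  rewrite -(opprK (dot _ _)) -dotNl -dotNr -[- x i]sub0r; over.
rewrite E lerDl mulr_ge0 // ?invr_ge0 ?ler0n //.
by apply: sumr_ge0 => i _; exact: dot_ge0.
Qed.

Lemma averageB x x' : average x - average x' = average (fun i => x i - x' i).
Proof. by rewrite /average -scalerBr sumrB. Qed.

Lemma sqr_l2norm_stackB x z :
  l2norm (stack x - kron_ones n z) ^+ 2 = \sum_i dot (x i - z) (x i - z).
Proof.
rewrite sqr_l2norm /dot pair_big.
rewrite (reindex (fun p : 'I_n * 'I_m => mxtens_index p)) /=; last first.
  by exists (@mxtens_unindex _ _) => ? _; [exact: mxtens_indexK|exact: mxtens_unindexK].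
apply: eq_bigr => -[i k] _ /=.
rewrite !mxE !mxtens_indexK /= ?mxE mul1r.
by rewrite !ord1.
Qed.

Lemma sqr_l2norm_stack x : l2norm (stack x) ^+ 2 = \sum_i dot (x i) (x i).
Proof.
rewrite -[stack x]subr0; have -> : 0 = kron_ones n 0 :> 'cV[R]_(n * m).
  by apply/matrixP => i j; rewrite !mxE mulr0.
by rewrite sqr_l2norm_stackB; apply: eq_bigr => i _; rewrite subr0.
Qed.

End Averages.

Section SpectralNorm.
Variable R : realType.

(** The defining supremum is a supremum of a bounded set (Cauchy-Schwarz on
    each row), so the spectral norm really is an operator norm. *)
Lemma l2norm_mulmx_le m p (A : 'M[R]_(m, p)) (x : 'cV[R]_p) :
  l2norm (A *m x) <= spectral_norm A * l2norm x.
Proof.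
have ub : has_ubound [set l2norm (A *m x) | x in [set x : 'cV[R]_p | l2norm x <= 1]].
  exists (Num.sqrt (\sum_i dot (row i A)^T (row i A)^T)) => _ [z /= z1 <-].
  apply: ler_wsqrtr; apply: ler_sum => i _.
  have -> : (A *m z) i 0 = dot (row i A)^T z.
    by rewrite mxE; apply: eq_bigr => k _; rewrite !mxE.
  apply: le_trans (sqr_dot_le _ _) _; rewrite ler_piMr ?dot_ge0 //.
  by rewrite -sqr_l2norm expr_le1 ?l2norm_ge0.
have [x0|xn0] := eqVneq (l2norm x) 0.
  rewrite (l2norm_eq0 x0) mulmx0 -(scale0r (0 : 'cV_m)) -(scale0r (0 : 'cV_p)).
  by rewrite !l2normZ normr0 !mul0r mulr0.
have x_gt0 : 0 < l2norm x by rewrite lt_neqAle eq_sym xn0 l2norm_ge0.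
rewrite -ler_pdivrMr //; apply: ub_le_sup => //=.
exists ((l2norm x)^-1 *: x); last first.
  by rewrite -scalemxAr l2normZ gtr0_norm ?invr_gt0 // mulrC.
by rewrite /= l2normZ gtr0_norm ?invr_gt0 // mulVf.
Qed.

Lemma normr_bilinear_le m p (A : 'M[R]_(m, p)) (w : 'cV[R]_m) (u : 'cV[R]_p) (M : R) :
  spectral_norm A <= M -> `|dot w (A *m u)| <= M * (l2norm u * l2norm w).
Proof.
move=> AM; apply: le_trans (normr_dot_le _ _) _.
rewrite [l2norm u * _]mulrC mulrCA ler_wpM2l ?l2norm_ge0 //.
apply: le_trans (l2norm_mulmx_le _ _) _.
by rewrite ler_wpM2r ?l2norm_ge0.
Qed.

End SpectralNorm.

(** * Trajectory distribution *)

Section TrajectoryMass.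
Variables (R : realType) (S A : finType).

Definition fcons (X : Type) k (x : X) (f : {ffun 'I_k -> X}) : {ffun 'I_k.+1 -> X} :=
  [ffun i => if unlift ord0 i is Some j then f j else x].

Lemma fcons0 (X : Type) k (x : X) (f : {ffun 'I_k -> X}) : fcons x f ord0 = x.
Proof. by rewrite ffunE unlift_none. Qed.

Lemma fconsS (X : Type) k (x : X) (f : {ffun 'I_k -> X}) j :
  fcons x f (lift ord0 j) = f j.
Proof. by rewrite ffunE liftK. Qed.

Lemma sum_ffun_recl (X : finType) k (F : {ffun 'I_k.+1 -> X} -> R) :
  \sum_f F f = \sum_x \sum_g F (fcons x g).
Proof.
rewrite pair_big (reindex (fun p : X * {ffun 'I_k -> X} => fcons p.1 p.2)) //=.
exists (fun f => (f ord0, [ffun j => f (lift ord0 j)])) => [[x g]|f] _ /=.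
  by rewrite fcons0; congr pair; apply/ffunP => j; rewrite ffunE fconsS.
apply/ffunP => i; rewrite ffunE.
by case: unliftP => [j ->|->]; rewrite ?ffunE.
Qed.

Lemma sum_ffun0 (X : finType) (F : {ffun 'I_0 -> X} -> R) (c : R) :
  (forall f, F f = c) -> \sum_f F f = c.
Proof.
move=> Fc; rewrite (eq_bigr (fun=> c)) // sumr_const.
by rewrite card_ffun card_ord expn0 mulr1n.
Qed.

(** The steps of the induction condition on the first transition; the start
    state has to vary because it becomes the second state of the path. *)
Lemma sum_path_weights (q : S -> A -> S -> R) k (s0 : S) :
  (forall s, \sum_a \sum_s' q s a s' = 1) ->
  \sum_(f : {ffun 'I_k -> S}) \sum_(g : {ffun 'I_k -> A})
    \prod_(h < k) q (fcons s0 f (widen_ord (leqnSn k) h)) (g h) (f h) = 1.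
Proof.
move=> q1; elim: k s0 => [|k IH] s0.
  by do 2![apply: sum_ffun0 => ?]; rewrite big_ord0.
rewrite sum_ffun_recl.
transitivity (\sum_s1 \sum_a q s0 a s1); last by rewrite exchange_big q1.
apply: eq_bigr => s1 _; under eq_bigr => f _ do rewrite sum_ffun_recl.
rewrite exchange_big; apply: eq_bigr => a _.
rewrite -[RHS]mulr1 -[X in _ = _ * X](IH s1) mulr_sumr; apply: eq_bigr => f _.
rewrite mulr_sumr; apply: eq_bigr => g _.
rewrite big_ord_recl !fcons0.
have -> : widen_ord (leqnSn k.+1) ord0 = ord0 by apply: val_inj.
rewrite fcons0; congr (_ * _); apply: eq_bigr => h _; rewrite !fconsS.
have -> : widen_ord (leqnSn k.+1) (lift ord0 h) = lift ord0 (widen_ord (leqnSn k) h).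
  exact: val_inj.
by rewrite fconsS.
Qed.

End TrajectoryMass.

Section Policy.
Variables (R : realType) (n H d : nat) (S A : finType) (E : marl R n d S A).
Implicit Types (i : 'I_n) (x u w : 'cV[R]_d) (tau : traj H S A).

Lemma traj_prob_ge0 i x tau : 0 <= traj_prob E i x tau.
Proof.
rewrite mulr_ge0 ?init_ge0 // prodr_ge0 // => h _.
by rewrite mulr_ge0 ?trans_ge0 // ltW ?policy_gt0.
Qed.

Lemma sum_traj_prob i x : \sum_(tau : traj H S A) traj_prob E i x tau = 1.
Proof.
transitivity (\sum_(f : {ffun 'I_H.+1 -> S}) \sum_(g : {ffun 'I_H -> A})
    traj_prob E i x (f, g)).
  by rewrite pair_bigA; apply: eq_bigr => -[].
rewrite sum_ffun_recl -[RHS](init_sum1 E i); apply: eq_bigr => s0 _.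
pose q s a s' := policy E x s a * trans E i s a s'.
have q1 s : \sum_a \sum_s' q s a s' = 1.
  rewrite -(policy_sum1 E x s); apply: eq_bigr => a _.
  by rewrite -mulr_sumr trans_sum1 mulr1.
rewrite -[RHS]mulr1 -[X in _ = _ * X](sum_path_weights H s0 q1) mulr_sumr.
apply: eq_bigr => f _; rewrite mulr_sumr; apply: eq_bigr => g _.
rewrite /traj_prob /= fcons0; congr (_ * _); apply: eq_bigr => h _.
by rewrite /q /state_at /action_at /next_state /= fconsS.
Qed.

Lemma normr_traj_return_le i tau : `|traj_return E i tau| <= (1 - discount E)^-1.
Proof.
have /andP[g0 g1] := discount_itv E.
have h1 : 0 < 1 - discount E by rewrite subr_gt0.
apply: (@le_trans _ _ (\sum_(h < H) discount E ^+ h)).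
  apply: le_trans (ler_norm_sum _ _ _) _; apply: ler_sum => h _.
  rewrite normrM ger0_norm ?exprn_ge0 // ler_piMr ?exprn_ge0 //.
  by rewrite ler_norml reward_bounded.
rewrite -[X in _ <= X]mul1r ler_pdivlMr // mulrC -opprB mulNr -subrX1 opprB.
by rewrite gerBl exprn_ge0.
Qed.

(** The gradient of the log-likelihood: the initial and transition probabilities
    do not depend on the parameter. *)
Definition traj_score tau x : 'cV[R]_d :=
  \sum_(h < H) score E (state_at tau h) (action_at tau h) x.

Definition traj_log_policy tau x : R :=
  \sum_(h < H) log_policy E (state_at tau h) (action_at tau h) x.

(** The factor of the likelihood that does not depend on the policy. *)
Definition traj_env_prob i tau : R :=
  init E i (tau.1 ord0) *
  \prod_(h < H) trans E i (state_at tau h) (action_at tau h) (next_state tau h).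

(** Exponential form of the likelihood: it turns the product rule over the
    horizon into a sum of scores. *)
Lemma traj_probE i x tau :
  traj_prob E i x tau = traj_env_prob i tau * expR (traj_log_policy tau x).
Proof.
rewrite /traj_prob /traj_env_prob expR_sum -mulrA -big_split /=; congr (_ * _).
apply: eq_bigr => h _; rewrite mulrC; congr (_ * _).
by rewrite lnK // posrE policy_gt0.
Qed.

End Policy.

(** * Derivatives along lines *)

Section LineDerivatives.
Variables (R : realType) (d : nat).
Implicit Types (x u w : 'cV[R]_d) (f : 'cV[R]_d -> R).

(** Restriction to lines: products, exponentials and the mean value theorem are
    then only needed for functions of one real variable. *)
Lemma is_derive_line f x u (s df : R) :
  is_derive (x + s *: u) u f df -> is_derive s 1 (fun r : R => f (x + r *: u)) df.
Proof.
case=> dfx <-.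
have E : (fun h : R => h^-1 *: ((f \o shift (x + s *: u)) (h *: u) - f (x + s *: u))) =
  (fun h => h^-1 *: (((fun r : R => f (x + r *: u)) \o shift s) (h *: 1) - f (x + s *: u))).
  by rewrite funeqE => h /=; rewrite [h *: 1]mulr1 scalerDl addrCA.
by split; [rewrite /derivable -E | rewrite /derive -E].
Qed.

Lemma dot_delta k w : dot w (delta_mx k 0) = w k 0.
Proof.
rewrite /dot (bigD1 k) //= mxE !eqxx mulr1 big1 ?addr0 // => j jk.
by rewrite mxE (negPf jk) mulr0.
Qed.

Lemma sum_delta u : u = \sum_k u k 0 *: delta_mx k 0.
Proof.
apply/colP => k; rewrite summxE (bigD1 k) //= !mxE !eqxx mulr1 big1 ?addr0 // => j jk.
by rewrite !mxE eq_sym (negPf jk) mulr0.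
Qed.

Lemma derive_dot_grad f x u : differentiable f x -> 'D_u f x = dot u (grad f x).
Proof.
move=> df; rewrite deriveE // [in LHS](sum_delta u) linear_sum /=.
by apply: eq_bigr => k _; rewrite linearZ /= mxE deriveE.
Qed.

Lemma is_derive_dot_grad f x u :
  differentiable f x -> is_derive x u f (dot u (grad f x)).
Proof.
by move=> df; rewrite -derive_dot_grad //; apply: derivableP; apply: diff_derivable.
Qed.

Lemma differentiable_coord_grad f x k :
  differentiable (grad f) x ->
  differentiable (fun z => 'D_(delta_mx k 0) f z : R) x.
Proof.
move=> df; have -> : (fun z => 'D_(delta_mx k 0) f z) = (fun N : 'cV[R]_d => N k 0 : R) \o grad f.
  by rewrite funeqE => z /=; rewrite mxE.
by apply: differentiable_comp => //; exact: differentiable_coord.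
Qed.

Lemma is_derive_big (I : finType) (F : I -> R -> R) (dF : I -> R) (s : R) :
  (forall i, is_derive s 1 (F i) (dF i)) ->
  is_derive s 1 (fun r => \sum_i F i r) (\sum_i dF i).
Proof.
move=> dFs; have -> : (fun r => \sum_i F i r) = \sum_i F i.
  by rewrite funeqE => r; elim/big_rec2: _ => // i a g _ ->.
by elim/big_ind2 : _ => // [|*]; [exact: is_derive_cst|exact: is_deriveD].
Qed.

Lemma is_derive_line_dot_grad f x u w (s : R) :
  twice_differentiable f ->
  is_derive s 1 (fun r : R => dot w (grad f (x + r *: u)))
    (dot w (hessian f (x + s *: u) *m u)).
Proof.
move=> f2; apply: is_derive_big => k.
set y := x + s *: u.
have -> : (fun r : R => w k 0 * grad f (x + r *: u) k 0) =
    w k 0 \*: (fun r : R => (fun z => 'D_(delta_mx k 0) f z : R) (x + r *: u)).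
  by rewrite funeqE => r; rewrite mxE.
apply: is_deriveZ; apply: (@is_derive_line (fun z => 'D_(delta_mx k 0) f z : R)).
have df := differentiable_coord_grad k (f2 y).2.
apply: is_derive_eq (is_derive_dot_grad u df) _.
by rewrite mxE; apply: eq_bigr => l _; rewrite !mxE mulrC.
Qed.

End LineDerivatives.

(** * Policy gradient and smoothness of the local values *)

Lemma derive_line (R : realType) (d : nat) (f : 'cV[R]_d -> R) (x u : 'cV[R]_d) :
  'D_u f x = 'D_1 (fun r : R => f (x + r *: u)) 0.
Proof.
have E : (fun h : R => h^-1 *: ((f \o shift x) (h *: u) - f x)) =
  (fun h => h^-1 *: (((fun r : R => f (x + r *: u)) \o shift 0) (h *: 1) -
     f (x + 0 *: u))).
  by rewrite funeqE => h /=; rewrite [h *: 1]mulr1 addr0 scale0r addr0 (addrC x).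
by rewrite /derive E.
Qed.

Lemma normr_increment_le (R : realType) (f df : R -> R) (c : R) :
  (forall s : R, is_derive s 1 f (df s)) -> (forall s, `|df s| <= c) ->
  `|f 1 - f 0| <= c.
Proof.
move=> dfs dfc.
have [s _ ->] : exists2 s, s \in `]0, 1[%R & f 1 - f 0 = df s * (1 - 0).
  apply: MVT => // s.
  by apply: derivable_within_continuous.
by rewrite subr0 mulr1.
Qed.

Lemma increment_ge0 (R : realType) (f df : R -> R) :
  (forall s : R, is_derive s 1 f (df s)) -> (forall s, 0 < s -> 0 <= df s) ->
  f 0 <= f 1.
Proof.
move=> dfs dfc; rewrite -subr_ge0.
have [s + ->] : exists2 s, s \in `]0, 1[%R & f 1 - f 0 = df s * (1 - 0).
  apply: MVT => // s.
  by apply: derivable_within_continuous.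
by rewrite in_itv /= => /andP[s0 _]; rewrite subr0 mulr1 dfc.
Qed.

Section PolicyGradient.
Variables (R : realType) (n H d : nat) (S A : finType) (E : marl R n d S A).
Implicit Types (i : 'I_n) (x u w : 'cV[R]_d) (tau : traj H S A).

Lemma is_derive_traj_prob i tau x u (s : R) :
  is_derive s 1 (fun r : R => traj_prob E i (x + r *: u) tau)
    (traj_prob E i (x + s *: u) tau * dot u (traj_score E tau (x + s *: u))).
Proof.
have dl : is_derive s 1 (fun r : R => traj_log_policy E tau (x + r *: u))
    (dot u (traj_score E tau (x + s *: u))).
  rewrite dot_sumr; apply: is_derive_big => h.
  apply: (@is_derive_line _ _ (log_policy E (state_at tau h) (action_at tau h))).
  apply: is_derive_dot_grad.
  by have [] := log_policy_diff2 E (state_at tau h) (action_at tau h) (x + s *: u).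
have -> : (fun r : R => traj_prob E i (x + r *: u) tau) =
    traj_env_prob E i tau \*: (expR \o (fun r : R => traj_log_policy E tau (x + r *: u))).
  by rewrite funeqE => r; rewrite traj_probE.
rewrite traj_probE -mulrA; apply: is_deriveZ.
Qed.


Lemma is_derive_local_value i x u (s : R) :
  is_derive s 1 (fun r : R => local_value H E i (x + r *: u))
    (\sum_(tau : traj H S A) traj_return E i tau *
       (traj_prob E i (x + s *: u) tau * dot u (traj_score E tau (x + s *: u)))).
Proof.
apply: is_derive_big => tau.
have -> : (fun r : R => traj_prob E i (x + r *: u) tau * traj_return E i tau) =
    traj_return E i tau \*: (fun r : R => traj_prob E i (x + r *: u) tau).
  by rewrite funeqE => r; rewrite mulrC.
by apply: is_deriveZ; exact: is_derive_traj_prob.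
Qed.

(** The policy gradient theorem, by the log-derivative trick. *)
Lemma grad_local_value i x :
  grad (local_value H E i) x =
  \sum_(tau : traj H S A)
    (traj_return E i tau * traj_prob E i x tau) *: traj_score E tau x.
Proof.
apply/colP => k; rewrite mxE derive_line.
have := is_derive_local_value i x (delta_mx k 0) 0.
rewrite scale0r addr0 => D; rewrite (@derive_val _ _ _ _ _ _ _ D) summxE.
by apply: eq_bigr => tau _; rewrite mxE dotC dot_delta mulrA.
Qed.

Lemma is_derive_local_value_grad i x u (s : R) :
  is_derive s 1 (fun r : R => local_value H E i (x + r *: u))
    (dot u (grad (local_value H E i) (x + s *: u))).
Proof.
apply: is_derive_eq (is_derive_local_value i x u s) _.
rewrite grad_local_value dot_sumr; apply: eq_bigr => tau _.
by rewrite dotZr mulrA.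
Qed.

(** The Hessian of the local value as a bilinear form: the expectation of the
    return times the Hessian of the log-likelihood plus the outer square of its
    gradient. *)
Definition local_value_hess i x (u w : 'cV[R]_d) : R :=
  \sum_(tau : traj H S A) traj_return E i tau *
    (traj_prob E i x tau *
       \sum_(h < H) dot w (hessian (log_policy E (state_at tau h) (action_at tau h)) x *m u)
     + dot w (traj_score E tau x) * (traj_prob E i x tau * dot u (traj_score E tau x))).

Lemma is_derive_grad_local_value i x u w (s : R) :
  is_derive s 1 (fun r : R => dot w (grad (local_value H E i) (x + r *: u)))
    (local_value_hess i (x + s *: u) u w).
Proof.
have -> : (fun r : R => dot w (grad (local_value H E i) (x + r *: u))) =
    (fun r => \sum_(tau : traj H S A) traj_return E i tau *
      (traj_prob E i (x + r *: u) tau * dot w (traj_score E tau (x + r *: u)))).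
  rewrite funeqE => r; rewrite grad_local_value dot_sumr.
  by apply: eq_bigr => tau _; rewrite dotZr mulrA.
apply: is_derive_big => tau.
set p := fun r : R => traj_prob E i (x + r *: u) tau.
set sc := fun r : R => dot w (traj_score E tau (x + r *: u)).
have -> : (fun r : R => traj_return E i tau * (traj_prob E i (x + r *: u) tau *
      dot w (traj_score E tau (x + r *: u)))) = traj_return E i tau \*: (p * sc).
  by rewrite funeqE.
apply: is_deriveZ; apply: is_deriveM; first exact: is_derive_traj_prob.
have -> : sc = (fun r : R => \sum_(h < H)
    dot w (score E (state_at tau h) (action_at tau h) (x + r *: u))).
  by rewrite funeqE => r; rewrite /sc dot_sumr.
apply: is_derive_big => h; apply: is_derive_line_dot_grad.
exact: log_policy_diff2.
Qed.

Variables (G M : R).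
Hypothesis score_bound : forall s a x, l2norm (score E s a x) ^+ 2 <= G.
Hypothesis hess_bound :
  forall s a x, spectral_norm (hessian (log_policy E s a) x) <= M.

Definition smoothness : R := H%:R * (M + H%:R * G) / (1 - discount E).

(** Term by term in the double sum, by <a, c> <= (|a|^2 + |c|^2) / 2. *)
Lemma sqr_traj_score_le tau x :
  l2norm (traj_score E tau x) ^+ 2 <= H%:R ^+ 2 * G.
Proof.
rewrite sqr_l2norm dot_suml.
have -> : H%:R ^+ 2 * G = \sum_(h < H) \sum_(k < H) G.
  by rewrite !sumr_const !card_ord -(mulr_natl (G *+ H)) -(mulr_natl G) expr2 mulrA.
apply: ler_sum => h _; rewrite dot_sumr; apply: ler_sum => k _.
set a := score _ _ _ _; set c := score _ _ _ _.
have ha : dot a a <= G by rewrite -sqr_l2norm score_bound.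
have hc : dot c c <= G by rewrite -sqr_l2norm score_bound.
by have := dot_ge0 (a - c); rewrite !dotE (dotC c a); lra.
Qed.

Lemma normr_local_value_hess_le i x u w :
  `|local_value_hess i x u w| <= smoothness * (l2norm u * l2norm w).
Proof.
have sp := sum_traj_prob H E i x.
set N := l2norm u * l2norm w.
have N0 : 0 <= N by rewrite mulr_ge0 ?l2norm_ge0.
have -> : smoothness * N = \sum_(tau : traj H S A) (1 - discount E)^-1 *
    (traj_prob E i x tau * (H%:R * M * N + H%:R ^+ 2 * G * N)).
  rewrite -mulr_sumr -mulr_suml sp mul1r /smoothness; ring.
apply: le_trans (ler_norm_sum _ _ _) _; apply: ler_sum => tau _.
rewrite normrM ler_pM ?normr_ge0 ?normr_traj_return_le //.
rewrite [dot w _ * _]mulrCA -mulrDr normrM ger0_norm ?traj_prob_ge0 //.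
rewrite ler_wpM2l ?traj_prob_ge0 //.
apply: le_trans (ler_normD _ _) _; apply: lerD.
  apply: le_trans (ler_norm_sum _ _ _) _.
  have -> : H%:R * M * N = \sum_(h < H) M * N.
    by rewrite sumr_const card_ord -[RHS]mulr_natl mulrA.
  by apply: ler_sum => h _; exact: normr_bilinear_le.
rewrite normrM; apply: le_trans (ler_pM _ _ (normr_dot_le _ _) (normr_dot_le _ _)) _ => //.
have -> : l2norm w * l2norm (traj_score E tau x) *
    (l2norm u * l2norm (traj_score E tau x)) = l2norm (traj_score E tau x) ^+ 2 * N.
  by rewrite /N; ring.
by rewrite ler_wpM2r ?sqr_traj_score_le.
Qed.

(** The derivative of <D, grad V_i> along the segment from z to x is bounded by
    the bilinear form; D is chosen as the difference of the gradients. *)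
Lemma grad_local_value_lipschitz i x z : 0 <= smoothness ->
  l2norm (grad (local_value H E i) x - grad (local_value H E i) z) <=
  smoothness * l2norm (x - z).
Proof.
move=> L0; set D := _ - _.
have [D0|Dn0] := eqVneq (l2norm D) 0; first by rewrite D0 mulr_ge0 ?l2norm_ge0.
have D_gt0 : 0 < l2norm D by rewrite lt_neqAle eq_sym Dn0 l2norm_ge0.
rewrite -(ler_pM2r D_gt0) -expr2 sqr_l2norm.
have := normr_increment_le (is_derive_grad_local_value i z (x - z) D)
  (fun s => normr_local_value_hess_le i (z + s *: (x - z)) (x - z) D).
rewrite scale1r scale0r addr0 (addrC z) subrK -dotNr -dotDr -/D.
by rewrite ger0_norm ?dot_ge0 // mulrA.
Qed.

(** Along the segment from x to x + u the value minus its quadratic lower model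
    has a nonnegative derivative, by the Lipschitz bound on the gradient. *)
Lemma local_value_ascent i x u : 0 <= smoothness ->
  local_value H E i x + dot u (grad (local_value H E i) x)
    - smoothness / 2 * dot u u <= local_value H E i (x + u).
Proof.
move=> L0; set g := grad _ x.
pose f := (fun r : R => local_value H E i (x + r *: u)) +
  ((- dot u g) \*: id + (smoothness / 2 * dot u u) \*: (fun r : R => r ^+ 2)).
have df (s : R) : is_derive s 1 f (dot u (grad (local_value H E i) (x + s *: u)) +
    (- dot u g + smoothness * s * dot u u)).
  apply: is_deriveD; first exact: is_derive_local_value_grad.
  by apply: is_derive_eq; rewrite /GRing.scale /=; field.
have h : f 0 <= f 1.
  apply: (increment_ge0 df) => s s_gt0.
  have le1 : - dot u (grad (local_value H E i) (x + s *: u) - g) <=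
     smoothness * s * dot u u.
    apply: le_trans (ler_norm _) _; rewrite normrN.
    apply: le_trans (normr_dot_le _ _) _.
    apply: le_trans (ler_wpM2l (l2norm_ge0 _) (grad_local_value_lipschitz i _ _ L0)) _.
    rewrite (addrC x) addrK.
    rewrite l2normZ gtr0_norm // -(sqr_l2norm u).
    by rewrite le_eqVlt; apply/orP; left; apply/eqP; ring.
  by move: le1; rewrite dotDr dotNr; lra.
move: h; rewrite /f !fctE /= scale1r scale0r addr0 expr1n expr0n /=.
rewrite /GRing.scale /=; lra.
Qed.

End PolicyGradient.

(** * Bounds on the Fisher information *)

(** A kernel vector v has mu |v|^2 <= 0. *)
Lemma coercive_unitmx (R : realType) (m : nat) (F : 'M[R]_m) (mu : R) :
  0 < mu -> (forall z, mu * dot z z <= dot z (F *m z)) -> F \in unitmx.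
Proof.
move=> mu_gt0 F_ge; rewrite -row_free_unit -kermx_eq0.
apply/rowV0P => v /sub_kermxP vF; apply: trmx_inj; rewrite trmx0.
have := F_ge v^T; rewrite -[dot _ (F *m _)]dot_trmx trmxK mulmxA vF mul0mx mxE.
rewrite pmulr_rle0 // => v0; apply: dot_eq0; apply/eqP.
by rewrite eq_le v0 dot_ge0.
Qed.

Section FisherInformation.
Variables (R : realType) (n H d : nat) (S A : finType) (E : marl R n d S A).
Implicit Types (i : 'I_n) (x z w : 'cV[R]_d).

Lemma dot_fisher i x w z :
  dot w (fisher H E i x *m z) =
  \sum_(tau : traj H S A) traj_prob E i x tau * (H%:R^-1 *
    \sum_(h < H) dot (score E (state_at tau h) (action_at tau h) x) z *
                 dot w (score E (state_at tau h) (action_at tau h) x)).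
Proof.
rewrite /fisher mulmx_suml dot_sumr; apply: eq_bigr => tau _.
rewrite -!scalemxAl !dotZr mulmx_suml dot_sumr; congr (_ * (_ * _)).
apply: eq_bigr => h _; set s := score _ _ _ _.
by rewrite -mulmxA [s^T *m z]mx11_scalar mul_mx_scalar dot_trmx dotZr.
Qed.

Lemma fisher_coercive i x (mu : R) z :
  loewner_ge (fisher H E i x) mu%:M -> mu * dot z z <= dot z (fisher H E i x *m z).
Proof.
case=> _ /(_ z); rewrite -mulmxA mulmxBl mul_scalar_mx dot_trmx !dotE.
by rewrite subr_ge0.
Qed.

Variable G : R.
Hypothesis score_bound : forall s a x, l2norm (score E s a x) ^+ 2 <= G.
Hypothesis H_gt0 : (0 < H)%N.

(** Each outer product of scores has norm at most G; the bound passes to their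
    expectation by pairing with w, and w = F z turns it into one on the norm. *)
Lemma l2norm_fisher_le i x z : l2norm (fisher H E i x *m z) <= G * l2norm z.
Proof.
set w := fisher H E i x *m z.
have le w' : dot w' w <= G * (l2norm z * l2norm w').
  rewrite dot_fisher.
  have -> : G * (l2norm z * l2norm w') = \sum_(tau : traj H S A)
      traj_prob E i x tau * (H%:R^-1 * \sum_(h < H) G * (l2norm z * l2norm w')).
    by rewrite -mulr_suml (mean_const H_gt0) sum_traj_prob mul1r.
  apply: ler_sum => tau _; rewrite ler_wpM2l ?traj_prob_ge0 //.
  rewrite ler_wpM2l ?invr_ge0 ?ler0n //; apply: ler_sum => h _.
  set s := score _ _ _ _; apply: le_trans (ler_norm _) _.
  rewrite normrM; apply: le_trans (ler_pM _ _ (normr_dot_le _ _) (normr_dot_le _ _)) _ => //.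
  have -> : l2norm s * l2norm z * (l2norm w' * l2norm s) =
     l2norm s ^+ 2 * (l2norm z * l2norm w') by ring.
  by rewrite ler_wpM2r ?mulr_ge0 ?l2norm_ge0 ?score_bound.
have [w0|wn0] := eqVneq (l2norm w) 0; last first.
  have w_gt0 : 0 < l2norm w by rewrite lt_neqAle eq_sym wn0 l2norm_ge0.
  by rewrite -(ler_pM2r w_gt0) -expr2 sqr_l2norm -mulrA le.
rewrite w0; have := le z; rewrite (l2norm_eq0 w0) dotC dot0l.
have [->|zn0] := eqVneq (l2norm z) 0; first by rewrite mulr0.
have z_gt0 : 0 < l2norm z by rewrite lt_neqAle eq_sym zn0 l2norm_ge0.
by rewrite mulrA pmulr_lge0.
Qed.

End FisherInformation.

(** * Smoothness of the global value and one iteration *)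

Section GlobalValue.
Variables (R : realType) (n H d : nat) (S A : finType) (E : marl R n d S A).
Variables (G M : R).
Hypothesis n_gt0 : (0 < n)%N.
Hypothesis score_bound : forall s a x, l2norm (score E s a x) ^+ 2 <= G.
Hypothesis hess_bound :
  forall s a x, spectral_norm (hessian (log_policy E s a) x) <= M.
Implicit Types (x u z : 'cV[R]_d).

Let L := smoothness H E G M.
Hypothesis L_ge0 : 0 <= L.

Lemma grad_value x :
  grad (value H E) x = average (fun i => grad (local_value H E i) x).
Proof.
apply/colP => k; rewrite mxE derive_line.
have D : is_derive (0 : R) 1 (fun r : R => value H E (x + r *: delta_mx k 0))
    (n%:R^-1 * \sum_i dot (delta_mx k 0) (grad (local_value H E i) (x + 0 *: delta_mx k 0))).
  have -> : (fun r : R => value H E (x + r *: delta_mx k 0)) =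
      n%:R^-1 \*: (fun r => \sum_i local_value H E i (x + r *: delta_mx k 0)).
    by rewrite funeqE.
  by apply: is_deriveZ; apply: is_derive_big => i; exact: is_derive_local_value_grad.
rewrite (@derive_val _ _ _ _ _ _ _ D) scale0r addr0 mxE summxE; congr (_ * _).
by apply: eq_bigr => i _; rewrite dotC dot_delta.
Qed.

Lemma value_ascent x u :
  value H E x + dot u (grad (value H E) x) - L / 2 * dot u u <= value H E (x + u).
Proof.
rewrite grad_value dot_average -(mean_const n_gt0 (L / 2 * _)) -mulrDr -mulrBr.
rewrite -big_split -sumrB /= ler_wpM2l ?invr_ge0 ?ler0n //.
by apply: ler_sum => i _; exact: local_value_ascent.
Qed.

Lemma sqr_grad_local_value_lipschitz i x z :
  l2norm (grad (local_value H E i) x - grad (local_value H E i) z) ^+ 2 <=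
  L ^+ 2 * dot (x - z) (x - z).
Proof.
rewrite -(sqr_l2norm (x - z)) -exprMn ler_pXn2r ?nnegrE ?(mulr_ge0 L_ge0) ?l2norm_ge0 //.
exact: grad_local_value_lipschitz.
Qed.

(** The gradient of the global value at z is the average of the local gradients
    at z, so convexity of the squared norm reduces this to each agent. *)
Lemma sqr_average_grad_dist (th : 'I_n -> 'cV[R]_d) z :
  l2norm (average (fun i => grad (local_value H E i) (th i)) - grad (value H E) z) ^+ 2
  <= L ^+ 2 * (n%:R^-1 * \sum_i dot (th i - z) (th i - z)).
Proof.
rewrite grad_value averageB sqr_l2norm; apply: le_trans (sqr_average_le _ _) _ => //.
rewrite mulrCA ler_wpM2l ?invr_ge0 ?ler0n // mulr_sumr.
by apply: ler_sum => i _; rewrite -sqr_l2norm; exact: sqr_grad_local_value_lipschitz.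
Qed.

Lemma sqr_grad_value_lipschitz x z :
  l2norm (grad (value H E) x - grad (value H E) z) ^+ 2 <=
  L ^+ 2 * dot (x - z) (x - z).
Proof.
rewrite [grad _ x]grad_value; apply: le_trans (sqr_average_grad_dist _ _) _.
by rewrite mean_const.
Qed.

End GlobalValue.

(** Half of mu |d|^2 <= <d, y> absorbs the error term <g - y, d>. *)
Lemma natural_gradient_ascent (R : realType) (m : nat) (g y d : 'cV[R]_m) (mu : R) :
  0 < mu -> mu * dot d d <= dot d y ->
  mu / 2 * dot d d - (2 * mu)^-1 * dot (g - y) (g - y) <= dot g d.
Proof.
move=> mu_gt0 coer; have := young_dot (g - y) d mu_gt0.
rewrite [dot (g - y) d]dotDl dotNl (dotC y d).
set e := dot (g - y) (g - y); set q := (2 * mu)^-1; lra.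
Qed.

Section Step.
Variables (R : realType) (n H d : nat) (S A : finType) (E : marl R n d S A).
Variables (G M mu : R).
Hypothesis n_gt0 : (0 < n)%N.
Hypothesis H_gt0 : (0 < H)%N.
Hypothesis score_bound : forall s a x, l2norm (score E s a x) ^+ 2 <= G.
Hypothesis hess_bound :
  forall s a x, spectral_norm (hessian (log_policy E s a) x) <= M.
Hypothesis mu_gt0 : 0 < mu.
Hypothesis fisher_bound : forall i x, loewner_ge (fisher H E i x) mu%:M.

Let L := smoothness H E G M.

Lemma sqr_norm_fisher_le i x z :
  dot (fisher H E i x *m z) (fisher H E i x *m z) <= G ^+ 2 * dot z z.
Proof.
have h := l2norm_fisher_le score_bound H_gt0 i x z.
rewrite -!sqr_l2norm -exprMn ler_pXn2r ?nnegrE ?l2norm_ge0 //.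
exact: le_trans (l2norm_ge0 _) h.
Qed.

(** mu |z|^2 <= <z, F z> <= G |z|^2.  Stated with a vector rather than as mu <= G,
    which can fail when d = 0. *)
Lemma fisher_bounds_le (z : 'cV[R]_d) : mu ^+ 2 * dot z z <= G ^+ 2 * dot z z.
Proof.
pose i0 := Ordinal n_gt0; set F := fisher H E i0 0.
have c := fisher_coercive z (fisher_bound i0 0).
have u := sqr_norm_fisher_le i0 0 z.
apply: le_trans _ u.
have := sqr_dot_le z (F *m z).
have [z0|zn0] := eqVneq (dot z z) 0; first by rewrite z0 mulr0 dot_ge0.
have z_gt0 : 0 < dot z z by rewrite lt_neqAle eq_sym zn0 dot_ge0.
move=> cs; rewrite -(ler_pM2l z_gt0); apply: le_trans _ cs.
have -> : dot z z * (mu ^+ 2 * dot z z) = (mu * dot z z) ^+ 2 by ring.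
by rewrite ler_pXn2r ?nnegrE ?(le_trans _ c) // mulr_ge0 ?dot_ge0 // ltW.
Qed.

(** The ascent of one iteration, multiplied by 8 G^2 / (eta mu), pays for the
    gradients at the local parameters; [average th + eta *: average D] is the
    next averaged parameter. *)
Lemma step_bound (eta : R) (th y D : 'I_n -> 'cV[R]_d) :
  (forall i, y i = fisher H E i (th i) *m D i) ->
  0 < eta -> eta <= mu / (8 * L) ->
  n%:R^-1 * \sum_i l2norm (grad (value H E) (th i)) ^+ 2 <=
  8 * G ^+ 2 / (eta * mu) *
    (value H E (average th + eta *: average D) - value H E (average th))
  - G ^+ 2 / n%:R * l2norm (stack D) ^+ 2
  + 76 * G ^+ 2 / mu ^+ 2 *
      l2norm (average (fun i => grad (local_value H E i) (th i)) - average y) ^+ 2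
  + 10 * G ^+ 2 / (n%:R * mu ^+ 2) *
      l2norm (stack y - kron_ones n (average y)) ^+ 2
  + 82 * G ^+ 2 * L ^+ 2 / (n%:R * mu ^+ 2) *
      l2norm (stack th - kron_ones n (average th)) ^+ 2.
Proof.
move=> yE eta_gt0 eta_le.
have L_gt0 : 0 < L.
  have := lt_le_trans eta_gt0 eta_le.
  by rewrite pmulr_rgt0 // invr_gt0 pmulr_rgt0.
have L_ge0 := ltW L_gt0.
have etaL : eta * L <= mu / 8.
  move: eta_le; rewrite -(ler_pM2r L_gt0) => /le_trans; apply.
  by rewrite le_eqVlt; apply/orP; left; apply/eqP; field; lra.
have n_neq0 : n%:R != 0 :> R by rewrite pnatr_eq0 -lt0n.
have mu_neq0 : mu != 0 by rewrite gt_eqF.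
have eta_neq0 : eta != 0 by rewrite gt_eqF.
have ninv_ge0 : 0 <= n%:R^-1 :> R by rewrite invr_ge0 ler0n.
rewrite !sqr_l2norm_stackB sqr_l2norm_stack sqr_l2norm.
under eq_bigr do rewrite sqr_l2norm.
pose mean (f : 'I_n -> R) := n%:R^-1 * \sum_i f i.
have mean_le f f' : (forall i, f i <= f' i) -> mean f <= mean f'.
  by move=> ff'; rewrite ler_wpM2l // ler_sum.
have meanD f f' : mean (fun i => f i + f' i) = mean f + mean f'.
  by rewrite /mean big_split mulrDr.
have meanZ c f : mean (fun i => c * f i) = c * mean f.
  by rewrite /mean -mulr_sumr mulrCA.
set g := grad (value H E) (average th).
set a := average (fun i => _) - _.
set Vp := value _ _ (_ + _); set V0 := value _ _ (average th).
pose SD := mean (fun i => dot (D i) (D i)).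
pose Sy := mean (fun i => dot (y i - average y) (y i - average y)).
pose St := mean (fun i => dot (th i - average th) (th i - average th)).
pose Se := mean (fun i => dot (g - y i) (g - y i)).
pose K := G ^+ 2 / mu ^+ 2.
have -> : G ^+ 2 / n%:R * (\sum_i dot (D i) (D i)) = G ^+ 2 * SD.
  by rewrite /SD /mean mulrA.
have -> : 10 * G ^+ 2 / (n%:R * mu ^+ 2) *
    (\sum_i dot (y i - average y) (y i - average y)) = 10 * K * Sy.
  by rewrite /K /Sy /mean; field; rewrite mu_neq0 n_neq0.
have -> : 82 * G ^+ 2 * L ^+ 2 / (n%:R * mu ^+ 2) *
    (\sum_i dot (th i - average th) (th i - average th)) = 82 * K * (L ^+ 2 * St).
  by rewrite /K /St /mean; field; rewrite mu_neq0 n_neq0.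
have -> : 76 * G ^+ 2 / mu ^+ 2 = 76 * K by rewrite /K mulrA.
(* A factor K can be put before every error term, since K >= 1 unless d = 0. *)
have leK f : (forall i, mu ^+ 2 * f i <= G ^+ 2 * f i) -> mean f <= K * mean f.
  move=> fle; rewrite /K mulrAC ler_pdivlMr ?exprn_gt0 // mulrC -!meanZ.
  exact: mean_le.
have SeK : Se <= K * Se by apply: leK => i; exact: fisher_bounds_le.
have StK : L ^+ 2 * St <= K * (L ^+ 2 * St).
  rewrite [K * _]mulrCA ler_wpM2l ?sqr_ge0 //; apply: leK => i; exact: fisher_bounds_le.
have K_ge0 : 0 <= K by rewrite divr_ge0 // sqr_ge0.
(* grad V(theta_i) = (grad V(theta_i) - g) + (g - y_i) + y_i, with y_i = F_i d_i. *)
have gradle : mean (fun i => dot (grad (value H E) (th i)) (grad (value H E) (th i))) <=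
    5 / 2 * (L ^+ 2 * St) + 5 * Se + 5 / 2 * (G ^+ 2 * SD).
  rewrite -!meanZ -!meanD; apply: mean_le => i.
  have := sqr_norm_add3_le (grad (value H E) (th i) - g) (g - y i) (y i).
  rewrite addrA !subrK => /le_trans; apply.
  apply: lerD; last by rewrite ler_wpM2l ?divr_ge0 // yE sqr_norm_fisher_le.
  rewrite lerD2r ler_wpM2l ?divr_ge0 // -sqr_l2norm.
  exact: sqr_grad_value_lipschitz.
have Se_le : Se <= 2 * (L ^+ 2 * St) + 2 * dot a a + Sy.
  rewrite /Se /mean mean_sqr_dist // -/(mean _) -/Sy lerD2r.
  have -> : g - average y = (g - average (fun i => grad (local_value H E i) (th i))) + a.
    by rewrite /a addrA subrK.
  apply: le_trans (sqr_norm_add_le _ _) _; rewrite lerD2r ler_wpM2l //.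
  by rewrite -opprB dotNl dotNr opprK -sqr_l2norm; exact: sqr_average_grad_dist.
(* The term mu/16 SD bounds L eta/2 |average D|^2, by eta L <= mu/8. *)
have asc : eta * (mu / 2 * SD - (2 * mu)^-1 * Se) - eta * (mu / 16 * SD) <= Vp - V0.
  rewrite lerBrDl; apply: le_trans _ (value_ascent _ _ _ _ _ _) => //.
  rewrite -/V0 -addrA lerD2l !(dotZl eta (average D)) (dotZr eta (average D)).
  apply: lerB.
    rewrite ler_pM2l // dotC dot_average -/(mean _) -!meanZ -[- mean _]mulN1r -meanZ -meanD.
    apply: mean_le => i; rewrite mulN1r; apply: natural_gradient_ascent => //.
    by rewrite yE fisher_coercive.
  have := sqr_average_le n_gt0 D; rewrite -/(mean _) -/SD => avD.
  have -> : L / 2 * (eta * (eta * dot (average D) (average D))) =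
    eta * ((eta * L) * (dot (average D) (average D) / 2)) by ring.
  rewrite ler_pM2l //.
  apply: le_trans (ler_wpM2r _ etaL) _; first by rewrite divr_ge0 ?dot_ge0.
  have -> : mu / 8 * (dot (average D) (average D) / 2) = mu / 16 * dot (average D) (average D) by field.
  by rewrite ler_wpM2l // divr_ge0 // ltW.
(* 7/2 = 8 (1/2 - 1/16): of it, 5/2 pays for the local gradients and 1 is left
   for the negative term in the sum of the |d_i|^2. *)
have asc' : G ^+ 2 * (7 / 2 * SD) - 4 * (K * Se) <= 8 * G ^+ 2 / (eta * mu) * (Vp - V0).
  have -> : G ^+ 2 * (7 / 2 * SD) - 4 * (K * Se) = 8 * G ^+ 2 / (eta * mu) *
     (eta * (mu / 2 * SD - (2 * mu)^-1 * Se) - eta * (mu / 16 * SD)).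
    by rewrite /K; field; rewrite mu_neq0 eta_neq0.
  apply: ler_wpM2l => //; apply: divr_ge0; last by rewrite ltW // mulr_gt0.
  by apply: mulr_ge0 => //; exact: sqr_ge0.
have KSe : K * Se <= K * (2 * (L ^+ 2 * St) + 2 * dot a a + Sy) by rewrite ler_wpM2l.
have mean_ge0 (u : 'I_n -> 'cV[R]_d) : 0 <= mean (fun i => dot (u i) (u i)).
  by apply: mulr_ge0 => //; apply: sumr_ge0 => i _; exact: dot_ge0.
have St_ge0 : 0 <= K * (L ^+ 2 * St).
  by apply: (mulr_ge0 K_ge0); apply: mulr_ge0; [exact: sqr_ge0 | exact: mean_ge0].
have Sy_ge0 : 0 <= K * Sy by apply: (mulr_ge0 K_ge0); exact: mean_ge0.
have a_ge0 : 0 <= K * dot a a by apply: (mulr_ge0 K_ge0); exact: dot_ge0.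
rewrite -/(mean _).
move: gradle SeK StK asc' KSe St_ge0 Sy_ge0 a_ge0.
set X := mean _; set P := K * Se; set Q := L ^+ 2 * St.
rewrite !mulrDr => h1 h2 h3 h4 h5 h6 h7 h8.
lra.
Qed.

End Step.

(** * Averaged recursion *)

Lemma average_mix (R : realType) (n m : nat) (W : 'M[R]_n) (x : 'I_n -> 'cV[R]_m) :
  doubly_stochastic W -> average (fun i => \sum_j W i j *: x j) = average x.
Proof.
case=> _ _ /rowP W1; rewrite /average exchange_big; congr (_ *: _).
apply: eq_bigr => j _; rewrite -scaler_suml.
have := W1 j; rewrite !mxE => E.
rewrite -[RHS]scale1r -[in RHS]E; congr (_ *: _).
by apply: eq_bigr => i _; rewrite mxE mul1r.
Qed.

Lemma averageD (R : realType) (n m : nat) (x z : 'I_n -> 'cV[R]_m) :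
  average (fun i => x i + z i) = average x + average z.
Proof. by rewrite /average big_split scalerDr. Qed.

Lemma averageZ (R : realType) (n m : nat) (c : R) (x : 'I_n -> 'cV[R]_m) :
  average (fun i => c *: x i) = c *: average x.
Proof. by rewrite /average -scaler_sumr !scalerA mulrC. Qed.

Section AveragedRecursion.
Variables (R : realType) (n H d : nat) (S A : finType) (E : marl R n d S A).
Variables (W : 'M[R]_n) (b : 'I_n -> R) (T B : nat) (eta beta : R).
Variables (theta0 : 'cV[R]_d) (tau0 : 'I_n -> 'I_B -> traj H S A).
Variables (tau : nat -> 'I_n -> traj H S A) (theta v y : nat -> 'I_n -> 'cV[R]_d).
Hypothesis W_ds : doubly_stochastic W.
Hypothesis alg : mdnpg_recursion E W b T eta beta theta0 tau0 tau theta v y.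

(** Mixing by [W] preserves averages, so the sum of the increments of [v]
    telescopes. *)
Lemma average_tracking t : (t <= T)%N -> average (y t.+1) = average (v t).
Proof.
have step s : (s <= T)%N ->
    average (y s.+1) = average (y s) + average (v s) - average (lag v s).
  move=> sT; rewrite -averageD averageB -[RHS](average_mix _ W_ds).
  by congr average; apply/funext => i; rewrite (mdnpg_y alg).
elim: t => [|t IH] tT; rewrite step //; last first.
  by rewrite (IH (ltnW tT)) addrAC subrr add0r.
have avg0 (x : 'I_n -> 'cV[R]_d) : (forall i, x i = 0) -> average x = 0.
  by move=> x0; rewrite /average big1 ?scaler0.
by rewrite !(avg0 (y 0%N), avg0 (lag v 0%N)) ?add0r ?subr0 // => i; exact: mdnpg_y0 alg i.
Qed.

Lemma average_theta t : (t <= T)%N ->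
  average (theta t.+1) =
  average (theta t) + eta *: average (direction H E theta y t).
Proof.
move=> tT; rewrite -averageZ -averageD -[RHS](average_mix _ W_ds).
by congr average; apply/funext => i; rewrite (mdnpg_theta alg).
Qed.

(** Every realization satisfies the bound: summing [step_bound] telescopes the
    ascent of the value along the averaged parameters. *)
Lemma mdnpg_path_bound (G M muF : R) :
  (0 < n)%N -> (0 < H)%N -> has_ubound (range (value H E)) ->
  (forall s a x, l2norm (score E s a x) ^+ 2 <= G) ->
  (forall s a x, spectral_norm (hessian (log_policy E s a) x) <= M) ->
  0 < muF -> (forall i x, loewner_ge (fisher H E i x) muF%:M) ->
  0 < eta -> eta <= muF / (8 * smoothness H E G M) ->
  n%:R^-1 * \sum_(0 <= t < T.+1) \sum_(i < n)
      l2norm (grad (value H E) (theta t i)) ^+ 2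
  <= 8 * G ^+ 2 * (sup (range (value H E)) - value H E theta0) / (eta * muF)
     - G ^+ 2 / n%:R * \sum_(0 <= t < T.+1)
         l2norm (stack (direction H E theta y t)) ^+ 2
     + 76 * G ^+ 2 / muF ^+ 2 * \sum_(0 <= t < T.+1)
         l2norm (average (fun i => grad (local_value H E i) (theta t i))
                 - average (v t)) ^+ 2
     + 10 * G ^+ 2 / (n%:R * muF ^+ 2) * \sum_(0 <= t < T.+1)
         l2norm (stack (y t.+1) - kron_ones n (average (y t.+1))) ^+ 2
     + 82 * G ^+ 2 * smoothness H E G M ^+ 2 / (n%:R * muF ^+ 2) *
       \sum_(0 <= t < T.+1)
         l2norm (stack (theta t) - kron_ones n (average (theta t))) ^+ 2.
Proof.
move=> n_gt0 H_gt0 V_bounded score_bound hess_bound muF_gt0 fisher_bound.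
move=> eta_gt0 eta_le.
have yE t i : y t.+1 i = fisher H E i (theta t i) *m direction H E theta y t i.
  rewrite mulmxA mulmxV ?mul1mx //; apply: (coercive_unitmx muF_gt0) => z.
  exact: fisher_coercive.
have step t := step_bound n_gt0 H_gt0 score_bound hess_bound muF_gt0
  fisher_bound (yE t) eta_gt0 eta_le.
have init : average (theta 0%N) = theta0.
  rewrite /average (eq_bigr (fun=> theta0)) => [|i _]; last exact: (mdnpg_theta0 alg).
  by rewrite sumr_const card_ord -(scaler_nat n theta0) scalerA mulVf ?scale1r // pnatr_eq0 -lt0n.
pose V t := value H E (average (theta t)).
have tele : 8 * G ^+ 2 / (eta * muF) * \sum_(0 <= t < T.+1) (V t.+1 - V t) <=
    8 * G ^+ 2 * (sup (range (value H E)) - value H E theta0) / (eta * muF).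
  rewrite telescope_sumr // [leRHS]mulrAC; apply: ler_wpM2l.
    apply: divr_ge0; last by rewrite ltW // mulr_gt0.
    by apply: mulr_ge0 => //; exact: sqr_ge0.
  rewrite {2}/V init lerD2r.
  by apply: ub_le_sup => //; exists (average (theta T.+1)).
rewrite -!addrA; apply: le_trans _ (lerD tele (lexx _)).
rewrite -mulNr !mulr_sumr -!big_split /=.
rewrite big_nat_cond [leRHS]big_nat_cond; apply: ler_sum => t.
rewrite andbT => /andP[_ tT].
have := step t; rewrite -(average_theta tT) average_tracking // -!addrA -(mulNr (G ^+ 2 / n%:R)).
exact.
Qed.

End AveragedRecursion.

Theorem lemma4p1
  (R : realType) (n H d : nat) (S A : finType) (E : marl R n d S A)
  (n_gt0 : (0 < n)%N) (H_gt0 : (0 < H)%N)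
  (adj : rel 'I_n) (adj_conn : connected_graph adj)
  (W : 'M[R]_n)
  (W_adj : forall i j, ~~ ((j == i) || adj i j) -> W i j = 0)
  (W_ds : doubly_stochastic W)
  (b : 'I_n -> R) (T B : nat) (B_gt0 : (0 < B)%N) (eta beta : R)
  (theta0 : 'cV[R]_d)
  (disp : measure_display) (Omega : measurableType disp)
  (Pr : probability Omega R)
  (tau0 : 'I_n -> 'I_B -> Omega -> traj H S A)
  (tau : nat -> 'I_n -> Omega -> traj H S A)
  (theta v y : nat -> 'I_n -> Omega -> 'cV[R]_d)
  (alg : mdnpg E W b T eta beta theta0 Pr tau0 tau theta v y)
  (V_bounded : has_ubound (range (value H E)))
  (G M muF : R)
  (score_bound : forall s a x, l2norm (score E s a x) ^+ 2 <= G)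
  (hess_bound : forall s a x, spectral_norm (hessian (log_policy E s a) x) <= M)
  (muF_gt0 : 0 < muF)
  (fisher_bound : forall i x, loewner_ge (fisher H E i x) muF%:M) :
  let Vstar := sup (range (value H E)) in
  let Delta := Vstar - value H E theta0 in
  let L := H%:R * (M + H%:R * G) / (1 - discount E) in
  0 < eta -> eta <= muF / (8 * L) ->
  forall w : Omega,
  let th t i := theta t i w in
  let vv t i := v t i w in
  let yy t i := y t i w in
  let dd t i := direction H E th yy t i in
  let avg_grad t := average (fun i => grad (local_value H E i) (th t i)) in
  n%:R^-1 * \sum_(0 <= t < T.+1) \sum_(i < n)
      l2norm (grad (value H E) (th t i)) ^+ 2
  <= 8 * G ^+ 2 * Delta / (eta * muF)
     - G ^+ 2 / n%:R * \sum_(0 <= t < T.+1) l2norm (stack (dd t)) ^+ 2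
     + 76 * G ^+ 2 / muF ^+ 2 * \sum_(0 <= t < T.+1)
         l2norm (avg_grad t - average (vv t)) ^+ 2
     + 10 * G ^+ 2 / (n%:R * muF ^+ 2) * \sum_(0 <= t < T.+1)
         l2norm (stack (yy t.+1) - kron_ones n (average (yy t.+1))) ^+ 2
     + 82 * G ^+ 2 * L ^+ 2 / (n%:R * muF ^+ 2) * \sum_(0 <= t < T.+1)
         l2norm (stack (th t) - kron_ones n (average (th t))) ^+ 2.
Proof.
move=> Vstar Delta L eta_gt0 eta_le w.
exact: (mdnpg_path_bound W_ds (mdnpg_step alg w)).
Qed.
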